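(* Let $n\geq 1$ be an integer and let $f_1,\dots,f_n:\mathbf{R}\to\mathbf{R}$ be $n$ continuous functions satisfying the following conditions: (b) $\limsup_{|t|\to+\infty}\frac{\left|\int_0^tf_k(s)\,ds\right|}{t^2}<+\infty$ for each $k=1,\dots,n$; (c) for each $k=1,\dots,n$, the function $t\mapsto\int_0^tf_k(s)\,ds$ is odd and vanishes only at $0$. Then, for each $a,r>0$ and $b<0$, there exists a number $\delta>0$ with the following property: for every $n$-tuple of continuous functions $g_1,\dots,g_n:\mathbf{R}\to\mathbf{R}$ satisfying $$\max_{1\leq k\leq n}\left(\sup_{t\in\mathbf{R}}\int_0^tg_k(s)\,ds-\inf_{t\in\mathbf{R}}\int_0^tg_k(s)\,ds\right)<\delta,$$ there exists $(\tilde\mu_1,\dots,\tilde\mu_n)\in\mathbf{R}^n$, with $\sum_{k=1}^n|\tilde\mu_k|^2<r^2$, such that the problem $$\begin{cases}-\left(a\sum_{m=1}^{n+1}|x_m-x_{m-1}|^2+b\right)(x_{k+1}-2x_k+x_{k-1})=g_k(x_k)+\tilde\mu_kf_k(x_k), & k=1,\dots,n,\\ x_0=x_{n+1}=0\end{cases}$$ has at least three solutions.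
   Context: A solution of the problem is a vector $(x_0,x_1,\dots,x_n,x_{n+1})\in\mathbf{R}^{n+2}$ with $x_0=x_{n+1}=0$ satisfying the displayed equation for every $k=1,\dots,n$; ''at least three solutions'' means at least three distinct such vectors. *)

(* Defs.v *)
From HB Require Import structures.
From mathcomp Require Export all_boot all_order all_algebra.
From mathcomp Require Export all_classical all_reals all_analysis.

Set Implicit Arguments.
Unset Strict Implicit.
Unset Printing Implicit Defensive.

Export Order.TTheory GRing.Theory Num.Theory.
Export numFieldNormedType.Exports.

Local Open Scope classical_set_scope.
Local Open Scope ring_scope.

(* The oriented integral of f from 0 to t: for t < 0 it is minus the integral
   over [t, 0]. *)
Definition int0 (R : realType) (f : R -> R) (t : R) : R :=
  if 0 <= t then \int[lebesgue_measure]_(s in `[0, t]) f s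
  else - \int[lebesgue_measure]_(s in `[t, 0]) f s.

(* The filter |t| --> +oo, generated by the sets {t : M < |t|}. *)
Definition abs_pinfty_nbhs (R : realType) : set_system R :=
  filter_from [set: R] (fun M => [set t | M < `|t|]).
Arguments abs_pinfty_nbhs R : clear implicits.

(* sup - inf over the line, in \bar R: it is +oo when G is unbounded. *)
Definition oscillation (R : realType) (G : R -> R) : \bar R :=
  (ereal_sup (range (EFin \o G)) - ereal_inf (range (EFin \o G)))%E.

(* A vector (x_0, ..., x_{n+1}) is a row of length n.+2. *)
Definition coord (R : realType) (n : nat) (x : 'rV[R]_n.+2) (k : nat) : R :=
  x 0 (inord k).

(* The families g, f and mu are 0-based: g k, f k and mu k, for k : 'I_n,
   belong to the equation at the node k.+1. *)
Definition is_solution (R : realType) (n : nat) (a b : R)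
    (g f : 'I_n -> R -> R) (mu : 'I_n -> R) (x : 'rV[R]_n.+2) : Prop :=
  [/\ coord x 0 = 0, coord x n.+1 = 0 &
    forall k : 'I_n,
      - (a * \sum_(1 <= m < n.+2) `|coord x m - coord x m.-1| ^+ 2 + b)
        * (coord x k.+2 - 2 * coord x k.+1 + coord x k)
      = g k (coord x k.+1) + mu k * f k (coord x k.+1)].

(* Main.v *)
(* The solutions are the critical points of the energies
     J_mu(u) = Phi(u) - sum_k G_k(u_k) - sum_k mu_k F_k(u_k)
   on R^n, where Phi = (a/4) q^2 + (b/2) q, q(u) is the sum of the squared
   differences of 0, u_1, ..., u_n, 0, and G_k, F_k are the primitives of g_k,
   f_k. Let mu range over the cube |mu_k| <= rho = r / (n + 1).

   Since b < 0, Phi has a negative minimum m, attained at some e and, by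
   evenness, at - e. As F_k vanishes only at 0,
   Phi(u) + rho sum_k |F_k(u_k)| >= m + gap for some gap > 0 and all u; take
   delta = gap / n. If every J_mu had a unique global minimizer,
   the minimax equality would hold in the form of a saddle point (mu0, u0):
   J_mu(u0) <= J_mu0(u) for all mu and u. For mu_k = - rho sgn F_k(u0_k) the left
   side is at least m + gap - sum_k G_k(u0_k). Since the F_k are odd, one of
   u = e, - e makes the right side at most m - sum_k G_k(u_k). Then the
   oscillations of the G_k would add up to at least gap, which is excluded. So
   some J_mu has two global minimizers, and the mountain pass theorem gives a
   third critical point. *)

Require Import Defs.
From mathcomp Require Import ring lra.

Set Implicit Arguments.
Unset Strict Implicit.
Unset Printing Implicit Defensive.

Local Open Scope classical_set_scope.
Local Open Scope ring_scope.

(** * Minimax *)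

Lemma closed_le_comp (R : realType) (T : topologicalType) (f : T -> R) (c : R) :
  continuous f -> closed [set x | f x <= c].
Proof.
move=> cf; rewrite (_ : [set _ | _] = f @^-1` [set x : R | x <= c]) //.
by apply: closed_comp; [move=> v _; exact: cf|exact: closed_le].
Qed.

Lemma closed_ge_comp (R : realType) (T : topologicalType) (f : T -> R) (c : R) :
  continuous f -> closed [set x | c <= f x].
Proof.
move=> cf; rewrite (_ : [set _ | _] = f @^-1` [set x : R | c <= x]) //.
by apply: closed_comp; [move=> v _; exact: cf|exact: closed_ge].
Qed.

Lemma compact_min (R : realType) (T : topologicalType) (f : T -> R)
    (X : set T) :
  X !=set0 -> compact X -> continuous f ->
  exists2 c, X c & forall t, X t -> f c <= f t.
Proof.
move=> X0 cX cf.
have [|c /set_mem Xc cmin] := compact_EVT_min X0 cX (f := f).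
  exact: continuous_subspaceT.
by exists c => // t Xt; apply: cmin; exact: mem_set.
Qed.

Lemma compact_max (R : realType) (T : topologicalType) (f : T -> R)
    (X : set T) :
  X !=set0 -> compact X -> continuous f ->
  exists2 c, X c & forall t, X t -> f t <= f c.
Proof.
move=> X0 cX cf; have cNf : continuous (- f).
  by move=> x; apply: continuousN; exact: cf.
have [c Xc cmin] := compact_min X0 cX cNf.
by exists c => // t Xt; rewrite -lerN2; exact: cmin.
Qed.

Lemma continuous_sum (R : realType) (T : topologicalType) (I : Type)
    (s : seq I) (P : pred I) (F : I -> T -> R) :
  (forall i, continuous (F i)) ->
  continuous (fun x => \sum_(i <- s | P i) F i x).
Proof.
move=> cF; elim: s => [|i s IH].
  by under eq_fun do rewrite big_nil; exact: cst_continuous.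
under eq_fun do rewrite big_cons.
case: (P i) => // x; apply: continuousD; [exact: cF|exact: IH].
Qed.

Lemma coord_le_norm (R : realType) m n (v : 'M[R]_(m, n)) i j :
  `|v i j| <= `|v|.
Proof.
have /mapP[k _ ->] : `|v i j| \in [seq `|v x.1 x.2| | x : 'I_m * 'I_n].
  by apply/mapP; exists (i, j) => //=; rewrite mem_enum.
by rewrite -[leRHS]/(mx_norm v) mx_normrE; apply/bigmax_geP; right => /=; exists k.
Qed.

Lemma mx_norm_le (R : realType) m n (v : 'M[R]_(m, n)) (M : R) :
  0 <= M -> (forall i j, `|v i j| <= M) -> `|v| <= M.
Proof.
move=> M0 vM; rewrite -[leLHS]/(mx_norm v) mx_normrE.
by apply/bigmax_leP; split => // -[i j] _; exact: vM.
Qed.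

Lemma compact_ball0 (R : realType) n (M : R) :
  compact [set v : 'rV[R]_n | `|v| <= M].
Proof.
apply: bounded_closed_compact.
  by exists M; split => [|N MN v /= vM]; rewrite ?num_real// (le_trans vM)// ltW.
by apply: closed_le_comp => v; exact: norm_continuous.
Qed.

Lemma pairing_le (R : realType) n (mu : 'rV[R]_n) (w : 'I_n -> R) :
  `|\sum_k mu 0 k * w k| <= `|mu| * \sum_k `|w k|.
Proof.
rewrite (le_trans (ler_norm_sum _ _ _))// mulr_sumr ler_sum// => k _.
by rewrite normrM ler_wpM2r// coord_le_norm.
Qed.

(** A one-sided bound suffices: exchanging [x] and [y] gives the other side. *)
Lemma lipschitz_continuous (R : realType) (V : normedModType R) (h : V -> R)
    (M : R) :
  0 < M -> (forall x y, h x - h y <= `|x - y| * M) -> continuous h.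
Proof.
move=> M0 hM x; apply/cvgrPdist_le => e e0; near=> y.
rewrite (@le_trans _ _ (`|x - y| * M))//.
  by rewrite ler_norml hM lerNl opprB distrC hM.
rewrite -ler_pdivlMr//; near: y.
move: (divr_gt0 e0 M0); move: (e / M).
by apply/cvgrPdist_le; exact: cvg_id.
Unshelve. all: by end_near. Qed.

(* At a maximizer mu0 of mu |-> min_x (A x - <mu, F x>) with minimizer x0, the
   minimizers x_t for the parameters mu0 + t (mu - mu0), t > 0, satisfy
   <mu - mu0, F x_t> >= 0. This passes to x0 because uniqueness of x0 forces
   them to approach it as t tends to 0. *)
Lemma saddle_point (R : realType) (T : topologicalType) n (X : set T)
    (A : T -> R) (F : 'I_n -> T -> R) (rho : R)
    (J := fun (mu : 'rV[R]_n) x => A x - \sum_k mu 0 k * F k x) :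
  X !=set0 -> compact X -> continuous A -> (forall k, continuous (F k)) ->
  0 <= rho ->
  (forall mu x y, `|mu| <= rho -> X x -> X y ->
     (forall z, X z -> J mu x <= J mu z) ->
     (forall z, X z -> J mu y <= J mu z) -> x = y) ->
  exists mu0 x0, [/\ `|mu0| <= rho, X x0 &
    forall mu x, `|mu| <= rho -> X x -> J mu x0 <= J mu0 x].
Proof.
move=> X0 cX cA cF rho0 uniq.
have cP w : continuous (fun x => \sum_k w k * F k x).
  apply: continuous_sum => k x; apply: continuousM; first exact: cvg_cst.
  exact: cF.
have cJ mu : continuous (J mu).
  by move=> x; apply: continuousB; [exact: cA|exact: cP].
have /choice[xm xmP] mu : exists x, X x /\ forall z, X z -> J mu x <= J mu z.
  by have [x] := compact_min X0 cX (cJ mu); exists x.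
have Xxm mu : X (xm mu) by case: (xmP mu).
have xmin mu z : X z -> J mu (xm mu) <= J mu z by case: (xmP mu) => _; apply.
have JB mu nu x : J mu x - J nu x = \sum_k (nu - mu) 0 k * F k x.
  rewrite (eq_bigr (fun k => nu 0 k * F k x - mu 0 k * F k x)).
    by rewrite sumrB /J; ring.
  by move=> k _; rewrite !mxE mulrBl.
have [M M0 FM] : exists2 M, 0 < M & forall x, X x -> \sum_k `|F k x| <= M.
  have [|c Xc cM] := compact_max (f := fun x => \sum_k `|F k x|) X0 cX.
    apply: continuous_sum => k x; apply: continuous_comp; first exact: cF.
    exact: norm_continuous.
  exists (1 + \sum_k `|F k c|).
    by rewrite ltr_wpDr// sumr_ge0.
  by move=> x Xx; rewrite ler_wpDl// cM.
pose h mu := J mu (xm mu).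
(* Each [J ^~ x] with [x] in [X] is [M]-Lipschitz in the parameter, so their lower envelope [h] is
   too. The minimizer for [nu] serves as competitor for [mu]. *)
have hlip mu nu : h mu - h nu <= `|mu - nu| * M.
  rewrite (@le_trans _ _ (J mu (xm nu) - J nu (xm nu)))//.
    by rewrite lerD2r xmin.
  rewrite JB (le_trans (ler_norm _))// (le_trans (pairing_le _ _))//.
  by rewrite distrC ler_wpM2l// FM.
have ch : continuous h.
  exact: lipschitz_continuous M0 hlip.
have [|mu0 /= mu0rho hmax] := compact_max (f := h) _ (@compact_ball0 R n rho) ch.
  by exists 0; rewrite /= normr0.
exists mu0, (xm mu0); split => // mu x murho Xx.
(* What remains is that [mu - mu0] pairs nonnegatively with [F] at [xm mu0]; suppose the pairing,
   called [w] below, is negative there. *)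
rewrite (@le_trans _ _ (h mu0)) ?xmin// -subr_le0 JB leNgt; apply/negP => lt0.
pose w x := \sum_k (mu - mu0) 0 k * F k x.
pose X' := X `&` [set x | 0 <= w x].
pose mt t := mu0 + t *: (mu - mu0).
have mtrho t : 0 <= t <= 1 -> `|mt t| <= rho.
  move=> /andP[t0 t1].
  have -> : mt t = (1 - t) *: mu0 + t *: mu.
    by rewrite /mt scalerBr scalerBl scale1r -addrA [- _ + _]addrC.
  rewrite (le_trans (ler_normD _ _))// !normrZ ger0_norm ?subr_ge0//.
  rewrite (ger0_norm t0).
  have : (1 - t) * `|mu0| <= (1 - t) * rho by rewrite ler_wpM2l// subr_ge0.
  have : t * `|mu| <= t * rho by rewrite ler_wpM2l.
  lra.
have Jmt t x' : J (mt t) x' = J mu0 x' - t * w x'.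
  have := JB (mt t) mu0 x'.
  rewrite (eq_bigr (fun k => - (t * ((mu - mu0) 0 k * F k x')))).
    by rewrite sumrN -mulr_sumr -/(w x') => e; lra.
  by move=> k _; rewrite !mxE; ring.
(* At [xm (mt t)], [J mu0 - t * w] equals [h (mt t)], which is at most [h mu0] by maximality, while
   [J mu0] is at least [h mu0]. Hence [t * w >= 0]. *)
have xmX' t : 0 < t <= 1 -> X' (xm (mt t)).
  move=> /andP[t0 t1]; split=> //=.
  rewrite -(pmulr_rge0 _ t0).
  have := hmax (mt t) (mtrho _ _); rewrite ltW//= => /(_ t1).
  have := xmin mu0 (xm (mt t)) (Xxm _).
  rewrite /h Jmt; lra.
have cX' : compact X'.
  by apply: compact_closedI => //; apply: closed_ge_comp; exact: cP.
have [||x' [Xx' wx'] x'min] := compact_min (f := J mu0) _ cX'.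
- by exists (xm (mt 1)); apply: xmX'; rewrite ltr01 lexx.
- exact: cJ.
(* In place of a limit, a quantitative separation: a point of [X'] reaching the value [h mu0] would
   be [xm mu0] by uniqueness, but [w] is negative there. *)
have gap : 0 < J mu0 x' - h mu0.
  rewrite subr_gt0 lt_neqAle xmin// andbT; apply/eqP => e.
  have xx' : x' = xm mu0.
    by apply: (uniq mu0) => // z Xz; rewrite -?e xmin.
  move: wx' lt0; rewrite /= xx' /w => w0; apply/negP; rewrite -leNgt.
  have -> : \sum_k (mu0 - mu) 0 k * F k (xm mu0) =
            - \sum_k (mu - mu0) 0 k * F k (xm mu0).
    by rewrite -sumrN; apply: eq_bigr => k _; rewrite -mulNr !mxE opprB.
  by rewrite oppr_le0.
have wle t : 0 < t <= 1 -> J mu0 x' - h mu0 <= t * w (xm (mt t)).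
  move=> t01; have /andP[t0 t1] := t01.
  have := hmax (mt t) (mtrho _ _); rewrite ltW//= => /(_ t1).
  have := x'min _ (xmX' _ t01).
  rewrite /h Jmt; lra.
pose K := 1 + `|mu - mu0| * M.
have K1 : 1 <= K by rewrite /K lerDl mulr_ge0// ltW.
have wK t : w (xm (mt t)) < K.
  rewrite /K ltr_pwDl// (le_trans (ler_norm _))//.
  by rewrite (le_trans (pairing_le _ _))// ler_wpM2l// FM.
(* With this [t], [t * K] is at most the separation, while [wle] and [w < K] make it strictly
   larger. *)
pose t := Num.min 1 ((J mu0 x' - h mu0) / K).
have K0 : 0 < K by rewrite (lt_le_trans ltr01).
have t0 : 0 < t by rewrite lt_min ltr01 divr_gt0.
have := wle t; rewrite t0 ge_min lexx => /(_ isT).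
rewrite leNgt => /negP; apply.
rewrite (@lt_le_trans _ _ (t * K)) ?ltr_pM2l//.
by rewrite -ler_pdivlMr// ge_min lexx orbT.
Qed.

(** * Mountain pass *)

Lemma slope_at_min (R : realType) (V : normedModType R) (J : V -> R) (x v : V)
    (d : R -> R) :
  (forall t : R, is_derive t 1 (fun t : R => J (x + t *: v)) (d t)) ->
  (forall z, J x <= J z) -> d 0 = 0.
Proof.
move=> dJ xmin.
have [_ <-] := dJ 0.
suff [_ ->] : is_derive (0 : R) 1 (fun t : R => J (x + t *: v)) 0 by [].
apply: (@derive1_at_min R _ (-1) 1).
- by rewrite (@le_trans _ _ 0)// ?lerN10 ?ler01.
- by move=> t _; case: (dJ t).
- by rewrite in_itv /= ltrN10 ltr01.
- by move=> t _; rewrite scale0r addr0.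
Qed.

(** The distance to [x] maps [C] onto an interval that contains [0] and [|y - x|]. *)
Lemma connected_crosses_sphere (R : realType) (V : normedModType R) (x y : V)
    (C : set V) (r : R) :
  connected C -> C x -> C y -> 0 <= r <= `|y - x| ->
  exists2 z, C z & `|z - x| = r.
Proof.
move=> cC Cx Cy rxy.
have /connected_intervalP : connected ((fun z => `|z - x|) @` C).
  apply: connected_continuous_connected => //.
  apply: continuous_subspaceT => z.
  apply: (continuous_comp (f := fun z => z - x)); last exact: norm_continuous.
  by apply: continuousB; [exact: cvg_id|exact: cvg_cst].
move=> /(_ 0 `|y - x| _ _ r rxy) [||z Cz zr]; last by exists z.
- by exists x => //; rewrite subrr normr0.
- by exists y.
Qed.

(* W is a descent field for J: along t |-> z - t W z the function J decreases
   at rate psi z t. The pass level c is the infimum of the levels t for which x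
   and y lie in a common connected subset of {J <= t}. Were c not critical,
   one step of descent would push such a subset below level c, and it would
   still contain x and y, where W vanishes. *)
Lemma mountain_pass (R : realType) (V : normedModType R) (J : V -> R)
    (W : V -> V) (psi : V -> R -> R) (x y : V) :
  (forall M : R, compact [set v : V | `|v| <= M]) ->
  continuous J -> (forall c, exists M, forall z, J z <= c -> `|z| <= M) ->
  continuous W -> continuous (fun p : V * R => psi p.1 p.2) ->
  (forall z (t : R), is_derive t 1 (fun t : R => J (z - t *: W z)) (- psi z t)) ->
  (forall z, 0 <= psi z 0) -> (forall z, psi z 0 = 0 -> W z = 0) ->
  x <> y -> (forall z, J x <= J z) -> (forall z, J y <= J z) ->
  exists z, [/\ psi z 0 = 0, z <> x & z <> y].
Proof.
move=> cB cJ coer cW cpsi dJ psi0 W0 xy xmin ymin.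
apply: contrapT => nocrit.
have crit_min z : (forall t, J z <= J t) -> psi z 0 = 0.
  move=> zmin; apply/eqP; rewrite -oppr_eq0; apply/eqP.
  apply: (slope_at_min (J := J) (x := z) (v := - W z) (d := fun t => - psi z t)) => // t.
  by under eq_fun do rewrite scalerN; exact: dJ.
have crit z : psi z 0 = 0 -> z = x \/ z = y.
  move=> z0; apply: contrapT => /not_orP[zx zy]; apply: nocrit; by exists z.
have csub (A : set V) c : (forall z, A z -> J z <= c) -> closed A -> compact A.
  have [M MJ] := coer c => Ac clA; apply: (subclosed_compact clA (cB M)).
  by move=> z /Ac /MJ.
pose rho := `|y - x| / 2.
have yx0 : 0 < `|y - x| by rewrite normr_gt0 subr_eq0; apply/eqP => /esym.
have cdist : continuous (fun z : V => `|z - x|).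
  move=> z.
  apply: (continuous_comp (f := fun z => z - x)); last exact: norm_continuous.
  by apply: continuousB; [exact: cvg_id|exact: cvg_cst].
pose S := [set z : V | `|z - x| = rho].
have S0 : S !=set0.
  exists (x + 2^-1 *: (y - x)); rewrite /S /= addrAC subrr add0r normrZ.
  by rewrite gtr0_norm ?invr_gt0// mulrC.
have cS : compact S.
  apply: (subclosed_compact _ (cB (rho + `|x|))); last first.
    by move=> z /= <-; rewrite -lerBlDr lerB_dist.
  rewrite (_ : S = [set z | `|z - x| <= rho] `&` [set z | rho <= `|z - x|]).
    by apply: closedI; [exact: closed_le_comp|exact: closed_ge_comp].
  apply/seteqP; split => z /=; first by move=> ->; rewrite lexx.
  by move=> [z1 z2]; apply/eqP; rewrite eq_le z1.
have [z0 z0S z0min] := compact_min S0 cS cJ.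
have rho0 : 0 < rho by rewrite divr_gt0.
(* Otherwise [z0] would be a global minimizer, hence critical, hence [x] or [y]. Both miss the
   sphere, whose radius is half their distance. *)
have Jz0 : J x < J z0.
  rewrite lt_neqAle xmin andbT; apply/eqP => e.
  have /crit_min/crit [z0x|z0y] : forall t, J z0 <= J t by move=> t; rewrite -e.
    by move: z0S rho0; rewrite /S /= z0x subrr normr0 => <-; rewrite ltxx.
  by move: z0S rho0; rewrite /S /= z0y /rho; move: yx0 => /[swap]; lra.
pose T := [set t : R | exists C : set V,
  [/\ connected C, C x, C y & forall z, C z -> J z <= t]].
have T0 : T !=set0.
  pose L := (fun t : R => x + t *: (y - x)) @` `[0, 1].
  have cL : continuous (fun t : R => x + t *: (y - x)).
    move=> t; apply: cvgD; first exact: cvg_cst.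
    by apply: cvgZr_tmp; exact: cvg_id.
  have [t [_ tmax]] : exists t, `[0, 1]%classic t /\
      forall s, `[0, 1]%classic s -> J (x + s *: (y - x)) <= J (x + t *: (y - x)).
    have [||t] := @compact_max R _ (fun t : R => J (x + t *: (y - x)))
        `[0, 1] _ (@segment_compact R 0 1).
    - by exists 0; rewrite /= in_itv /= lexx ler01.
    - by move=> t; apply: continuous_comp; [exact: cL|exact: cJ].
    by exists t.
  exists (J (x + t *: (y - x))), L; split.
  - apply: connected_continuous_connected; first exact: segment_connected.
    exact: continuous_subspaceT.
  - by exists 0; rewrite ?scale0r ?addr0//= in_itv /= lexx ler01.
  - by exists 1; rewrite ?scale1r ?subrKC//= in_itv /= lexx ler01.
  - by move=> _ [s s01 <-]; exact: tmax.
(* Every connected set joining [x] to [y] meets the sphere, which puts the pass level strictly above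
   [J x]. *)
have Tlb : lbound T (J z0).
  move=> t [C [cC Cx Cy Ct]].
  have [|z Cz zr] := connected_crosses_sphere (r := rho) cC Cx Cy.
    by rewrite ltW//= /rho; move: yx0; lra.
  by rewrite (le_trans (z0min _ zr))// Ct.
pose c := inf T.
have Jc : J x < c by rewrite (lt_le_trans Jz0)// lb_le_inf.
have cT t : T t -> c <= t by move=> Tt; apply: (ge_inf (E := T)) => //; exists (J z0).
(* The half keeps the band [K] of levels within [e0] of [c] strictly above [J x], the common level
   of [x] and [y], so that it has no critical point. The cap [1] keeps the levels up to [c + e0]
   inside [B]. *)
pose e0 := Num.min 1 ((c - J x) / 2).
have e00 : 0 < e0 by rewrite lt_min ltr01 divr_gt0// subr_gt0.
have e0x : J x < c - e0.
  have : e0 <= (c - J x) / 2 by rewrite ge_min lexx orbT.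
  by move: Jc; lra.
pose B := [set z | J z <= c + 1].
have cptB : compact B by apply: (csub _ (c + 1)) => //; exact: closed_le_comp.
pose K := [set z | J z <= c + e0] `&` [set z | c - e0 <= J z].
have cK : compact K.
  apply: (csub _ (c + e0)) => [z []//|].
  by apply: closedI; [exact: closed_le_comp|exact: closed_ge_comp].
have cpsi0 : continuous (psi ^~ 0).
  move=> z; apply: (continuous_comp (f := fun z => (z, 0 : R)) (g := fun p => psi p.1 p.2)).
    apply: (@cvg_pair _ _ _ _ (nbhs z) (nbhs (0 : R))); first exact: cvg_id.
    exact: cvg_cst.
  exact: cpsi.
have [nu nu0 psiK] : exists2 nu, 0 < nu & forall z, K z -> nu <= psi z 0.
  have [K0|/set0P/negP/negPn/eqP K0] := pselect (K !=set0); last first.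
    by exists 1 => // z; rewrite K0.
  have [z1 Kz1 z1min] := compact_min K0 cK cpsi0.
  exists (psi z1 0) => //.
  rewrite lt_neqAle psi0 andbT eq_sym; apply/eqP => /crit z1xy.
  have : J z1 = J x.
    by case: z1xy => ->//; apply/eqP; rewrite eq_le xmin ymin.
  by move: e0x; case: Kz1 => _ /= + + e; rewrite e; lra.
(* By continuity the bound holds around each [(z, 0)]; compactness of [B] makes the range of [t]
   uniform in [z]. *)
have [s0 s00 psis] : exists2 s0, 0 < s0 & forall t z, `|t| < s0 -> B z ->
    psi z 0 - nu / 2 <= psi z t.
  have := (compact_near_coveringP B).1 cptB R (nbhs 0)
    (fun t z => psi z 0 - nu / 2 <= psi z t) _.
  case.
    move=> z _.
    have : (fun p : V * R => psi p.1 p.2 - psi p.1 0) @ (z, 0 : R) --> psi z 0 - psi z 0.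
      apply: cvgB; first exact: (cpsi (z, 0)).
      by apply: (cvg_comp fst (psi ^~ 0) cvg_fst); exact: cpsi0.
    rewrite subrr => /cvgr_ge /(_ (- (nu / 2))).
    rewrite oppr_lt0 divr_gt0// => /(_ isT).
    by apply: filterS => -[z' t] /=; rewrite lerBlDr lerNl opprB; lra.
  move=> s0 /= s00 H; exists s0 => // t z ts0 Bz.
  by apply: H => //=; rewrite sub0r normrN.
(* The first bound makes the descent rate lose at most [nu / 2] along the step. The second gives
   [s * nu <= e0], so that points starting below the band end below [c - s * nu / 4]. *)
pose s := Num.min (s0 / 2) (e0 / nu).
have s_gt0 : 0 < s by rewrite lt_min !divr_gt0.
have ss0 : s < s0.
  rewrite (@le_lt_trans _ _ (s0 / 2)) ?ge_min ?lexx//; move: s00; lra.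
have snu : s * nu <= e0 by rewrite -ler_pdivlMr// ge_min lexx orbT.
have snu0 : 0 < s * nu by rewrite mulr_gt0.
have descent z : B z -> J (z - s *: W z) <= J z - s * (psi z 0 - nu / 2).
  move=> Bz.
  have [|t ts] := @MVT R (fun t => J (z - t *: W z)) (fun t => - psi z t) 0 s s_gt0
      (fun t _ => dJ z t).
    by apply: derivable_within_continuous => t _; case: (dJ z t).
  rewrite scale0r subr0 => e.
  have : psi z 0 - nu / 2 <= psi z t.
    apply: psis => //; move: ts; rewrite in_itv /= => /andP[t0 ts].
    by rewrite gtr0_norm// (lt_trans ts).
  by rewrite -(ler_pM2r s_gt0); move: e; lra.
have [t1 [C [cC Cx Cy Ct]] tc] : exists2 t, T t & t < c + s * nu / 4.
  by apply: inf_adherent; [rewrite divr_gt0|split => //; exists (J z0)].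
pose eta z := z - s *: W z.
suff /cT : T (c - s * nu / 4) by move: snu0; lra.
exists (eta @` C); split.
- apply: connected_continuous_connected => //; apply: continuous_subspaceT => z.
  apply: cvgB; first exact: cvg_id.
  by apply: cvgZl_tmp; exact: cW.
- by exists x => //; rewrite /eta W0 ?scaler0 ?subr0//; exact: crit_min.
- by exists y => //; rewrite /eta W0 ?scaler0 ?subr0//; exact: crit_min.
- move=> _ [z Cz <-]; have Jz := Ct z Cz.
  have e01 : e0 <= 1 by rewrite ge_min lexx.
  have Bz : B z by rewrite /B /=; move: snu snu0 tc; lra.
  have := descent z Bz; rewrite -/(eta z) => etaz.
  (* Inside the band the step gains at least [s * nu / 2], from a level below [c + s * nu / 4].
     Below the band it may lose up to [s * nu / 2], which the margin [e0] absorbs. *)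
  have [zc|zc] := leP (c - e0) (J z).
    have : nu <= psi z 0 by apply: psiK; split => //=; move: snu snu0 tc; lra.
    rewrite -(ler_pM2l s_gt0); move: etaz tc; lra.
  have := psi0 z; rewrite -(ler_pM2l s_gt0); move: etaz snu; lra.
Qed.

(** * Primitives of continuous functions *)

(** Near [x], [int0 f] differs by a constant from the integral with fixed left end [c], to which the
    fundamental theorem of calculus applies. As [c] lies below both [0] and [x], both branches of
    [int0] are covered. *)
Lemma is_derive_int0 (R : realType) (f : R -> R) (x : R) :
  continuous f -> is_derive x 1 (int0 f) (f x).
Proof.
move=> cf; pose c : R := - (`|x| + 1); pose u : R := `|x| + 1.
have fi (p q : R) : lebesgue_measure.-integrable `[p, q] (EFin \o f).
  apply: continuous_compact_integrable; first exact: segment_compact.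
  exact: continuous_subspaceT.
have c0 : c < 0 by rewrite oppr_lt0 ltr_wpDl.
have /andP[cx xu] : c < x < u.
  by rewrite -ltr_norml ltrDl.
pose F (s : R) : R := \int[lebesgue_measure]_(t in `[c, s]) f t.
have F0 (s : R) : c < s -> int0 f s = F s - F 0.
  move=> cs; rewrite /int0 /F; case: ifPn => [s0|].
    rewrite Rintegral_itvB ?bnd_simp//; last exact: ltW.
    by rewrite Rintegral_itv_obnd_cbnd//; apply: integrableS (fi 0 s) => //;
      apply: subset_itvr; rewrite bnd_simp.
  rewrite -ltNge => s0; rewrite -[RHS]opprB; congr (- _).
  rewrite Rintegral_itvB ?bnd_simp//; [|exact: ltW..].
  by rewrite Rintegral_itv_obnd_cbnd//; apply: integrableS (fi s 0) => //;
    apply: subset_itvr; rewrite bnd_simp.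
have [dF F'x] : derivable F x 1 /\ derive1 F x = f x.
  exact: (continuous_FTC1_closed xu (fi c u) cx (cf x)).
have isF : is_derive x 1 F (f x).
  by apply: DeriveDef => //; rewrite -F'x derive1E.
apply: (near_eq_is_derive (f := fun s => F s - F 0)).
  near=> s; rewrite F0//; near: s; exact: lt_nbhsr.
rewrite -[f x]subr0.
exact: is_deriveB.
Unshelve. all: by end_near. Qed.

Lemma continuous_int0 (R : realType) (f : R -> R) :
  continuous f -> continuous (int0 f).
Proof.
move=> cf x; apply: differentiable_continuous; apply/derivable1_diffP.
by case: (is_derive_int0 x cf).
Qed.

(** The finite limsup bounds the quotient for large [|t|]; on the remaining compact interval
    continuity bounds [F], which accounts for the additive constant. *)
Lemma quadratic_growth (R : realType) (F : R -> R) :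
  continuous F ->
  (limf_esup (fun t : R => (`|F t| / t ^+ 2)%:E) (abs_pinfty_nbhs R) < +oo)%E ->
  exists2 C, 0 <= C & forall t, `|F t| <= C * t ^+ 2 + C.
Proof.
move=> cF; rewrite limf_esupE => /ereal_inf_lt[_ /= [V [M _ MV] <-]] supV.
have [r r0 rV] : exists2 r, 0 <= r & forall t, V t -> `|F t| / t ^+ 2 <= r.
  have ub t : V t -> ((`|F t| / t ^+ 2)%:E <=
      ereal_sup [set (`|F t| / t ^+ 2)%:E | t in V])%E.
    by move=> Vt; apply: ereal_sup_ubound; exists t.
  (* The value [-oo] would mean that [V] is empty, and then any bound does. *)
  move: supV ub; case: (ereal_sup _) => // [r _|_] ub; last first.
    by exists 0 => // t /ub; rewrite leeNy_eq.
  exists (Num.max 0 r); first by rewrite le_max lexx.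
  by move=> t /ub; rewrite lee_fin le_max => ->; rewrite orbT.
have cnF : continuous (fun t => `|F t|).
  move=> t; apply: continuous_comp; [exact: cF|exact: norm_continuous].
have [|t0 _ t0max] := @compact_max R _ (fun t => `|F t|)
    `[- `|M|, `|M|] _ (@segment_compact R _ _) cnF.
  by exists 0; rewrite /= in_itv /= oppr_le0 normr_ge0.
exists (r + `|F t0|) => [|t]; first by rewrite addr_ge0.
have [tM|Mt] := leP `|t| `|M|.
  have : `|F t| <= `|F t0| by apply: t0max; rewrite /= in_itv /= -ler_norml.
  have := normr_ge0 (F t0); have := sqr_ge0 t; nra.
have t2 : 0 < t ^+ 2.
  rewrite exprn_even_gt0//= -normr_gt0.
  by rewrite (le_lt_trans _ Mt).
have /rV : V t by apply: MV; rewrite /= (le_lt_trans (ler_norm M)).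
rewrite ler_pdivrMr// => /le_trans; apply.
have := normr_ge0 (F t0); nra.
Qed.

Lemma oscillation_lt (R : realType) (G : R -> R) (delta : R) :
  (oscillation G < delta%:E)%E -> forall s t, G s - G t < delta.
Proof.
move=> Gd s t; rewrite -lte_fin EFinB; apply: le_lt_trans Gd.
apply: leeB; first by apply: ereal_sup_ubound; exists s.
by apply: ereal_inf_lbound; exists t.
Qed.

(** * The discrete Kirchhoff energy *)

(** Extension of [u] by zero to all of [nat], shifted by one: the boundary values hold by
    construction, and no index carries a bound. *)
Definition node (R : realType) n (u : 'rV[R]_n) (k : nat) : R :=
  if k is j.+1 then oapp (u 0) 0 (insub j) else 0.

Definition dirichlet (R : realType) n (u : 'rV[R]_n) : R :=
  \sum_(k < n.+1) (node u k.+1 - node u k) ^+ 2.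

(** The second difference is centred at the node [k.+1], in accordance with the 0-based
    equations. *)
Definition laplacian (R : realType) n (u : 'rV[R]_n) (k : nat) : R :=
  node u k.+2 - 2 * node u k.+1 + node u k.

Lemma node_ord (R : realType) n (u : 'rV[R]_n) (k : 'I_n) : node u k.+1 = u 0 k.
Proof. by rewrite /node valK. Qed.

Lemma node_last (R : realType) n (u : 'rV[R]_n) : node u n.+1 = 0.
Proof. by rewrite /node insubN ?ltnn. Qed.

Lemma nodeD (R : realType) n (u v : 'rV[R]_n) (t : R) k :
  node (u + t *: v) k = node u k + t * node v k.
Proof.
case: k => [|k] /=; first by rewrite mulr0 addr0.
by case: insub => [i|] /=; rewrite ?mxE// mulr0 addr0.
Qed.

Arguments node : simpl never.

Lemma continuous_node (R : realType) n k : continuous (fun u : 'rV[R]_n => node u k).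
Proof.
case: k => [|k]; rewrite /node /=; first exact: cst_continuous.
by case: insub => [i|] /=; [exact: coord_continuous|exact: cst_continuous].
Qed.

Lemma continuous_dirichlet (R : realType) n : continuous (@dirichlet R n).
Proof.
apply: continuous_sum => k.
have cn j : continuous (fun u : 'rV[R]_n => node u j) by exact: continuous_node.
have cd : continuous (fun u : 'rV[R]_n => node u k.+1 - node u k).
  by move=> u; exact: (continuousB (cn k.+1 u) (cn k u)).
by move=> u; exact: (continuousM (cd u) (cd u)).
Qed.

Lemma dirichlet_ge0 (R : realType) n (u : 'rV[R]_n) : 0 <= dirichlet u.
Proof. by apply: sumr_ge0 => k _; exact: sqr_ge0. Qed.

Lemma dirichletZ (R : realType) n (u : 'rV[R]_n) (t : R) :
  dirichlet (t *: u) = t ^+ 2 * dirichlet u.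
Proof.
rewrite /dirichlet mulr_sumr; apply: eq_bigr => k _.
rewrite -[t *: u]add0r !nodeD.
have n0 j : node (0 : 'rV[R]_n) j = 0.
  by case: j => //= j; rewrite /node; case: insub => //= i; rewrite mxE.
by rewrite !n0; ring.
Qed.

Lemma dirichlet0 (R : realType) n : dirichlet (0 : 'rV[R]_n) = 0.
Proof. by rewrite -[0 in LHS](scale0r 0) dirichletZ expr0n mul0r. Qed.

Lemma dirichletN (R : realType) n (u : 'rV[R]_n) : dirichlet (- u) = dirichlet u.
Proof. by rewrite -scaleN1r dirichletZ sqrrN expr1n mul1r. Qed.

(** A crude discrete Poincaré inequality. With [d] and [e] the values at consecutive nodes,
    [d ^+ 2 <= 2 * e ^+ 2 + 2 * (d - e) ^+ 2], so the constant doubles at each node. *)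
Lemma node_sqr_le (R : realType) n (u : 'rV[R]_n) k :
  (k <= n.+1)%N -> node u k ^+ 2 <= 2 ^+ k * dirichlet u.
Proof.
move=> kn; pose Q j := \sum_(i < j) (node u i.+1 - node u i) ^+ 2.
have /le_trans : node u k ^+ 2 <= 2 ^+ k * Q k.
  elim: k {kn} => [|k IH]; first by rewrite /Q big_ord0 expr0n mulr0.
  have QS : Q k.+1 = Q k + (node u k.+1 - node u k) ^+ 2.
    by rewrite /Q big_ord_recr.
  rewrite QS [2 ^+ k.+1]exprS.
  have p1 : 1 <= 2 ^+ k :> R by rewrite exprn_ege1// ler1n.
  have d2 := sqr_ge0 (node u k.+1 - node u k).
  have := sqr_ge0 (node u k.+1 - 2 * node u k).
  have := ler_wpM2r d2 p1.
  move: IH d2; set d := node u k.+1; set e := node u k; set P := 2 ^+ k.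
  by set q := Q k; nra.
apply; rewrite ler_wpM2l ?exprn_ge0//.
rewrite /dirichlet -(subnKC kn) big_split_ord /= lerDl.
by apply: sumr_ge0 => i _; exact: sqr_ge0.
Qed.

Lemma coord_sqr_le (R : realType) n (u : 'rV[R]_n) (k : 'I_n) :
  u 0 k ^+ 2 <= 2 ^+ n * dirichlet u.
Proof.
rewrite -node_ord (le_trans (node_sqr_le _ _))//; first by rewrite ltnS ltnW.
by rewrite ler_wpM2r ?dirichlet_ge0// ler_eXn2l// ltr1n.
Qed.

(** The boundary term at [N.+1] is kept for the induction; it vanishes for [y = node v] and
    [N = n]. *)
Lemma summation_by_parts (R : realType) (x y : nat -> R) N : y 0%N = 0 ->
  \sum_(k < N.+1) (x k.+1 - x k) * (y k.+1 - y k) =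
  (x N.+1 - x N) * y N.+1
    - \sum_(k < N) (x k.+2 - 2 * x k.+1 + x k) * y k.+1.
Proof.
move=> y0; elim: N => [|N IH]; first by rewrite big_ord1 big_ord0 y0 !subr0.
by rewrite big_ord_recr /= IH [in RHS]big_ord_recr /=; ring.
Qed.

(** On the line the energy is a quadratic polynomial with derivative [2 * (p + t * dirichlet v)],
    which summation by parts rewrites through the Laplacian. *)
Lemma dirichlet_line (R : realType) n (u v : 'rV[R]_n) (t : R) :
  is_derive t 1 (fun t : R => dirichlet (u + t *: v))
    (- 2 * \sum_(k < n) laplacian (u + t *: v) k * v 0 k).
Proof.
pose d (w : 'rV[R]_n) (k : nat) := node w k.+1 - node w k.
pose p := \sum_(k < n.+1) d u k * d v k.
have dE s : dirichlet (u + s *: v) = dirichlet u + s * (2 * p) + s ^+ 2 * dirichlet v.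
  rewrite /dirichlet /p !mulr_sumr -!big_split /=; apply: eq_bigr => k _.
  by rewrite !nodeD /d; ring.
have -> : (fun t : R => dirichlet (u + t *: v)) =
    (fun s => dirichlet u + s * (2 * p) + s ^+ 2 * dirichlet v).
  by apply/funext => s; exact: dE.
have sbp : - \sum_(k < n) laplacian (u + t *: v) k * v 0 k = p + t * dirichlet v.
  have := summation_by_parts (node (u + t *: v)) n (erefl (node v 0)).
  rewrite (node_last v) mulr0 sub0r.
  rewrite (eq_bigr (fun k : 'I_n => laplacian (u + t *: v) k * v 0 k)); last first.
    by move=> k _; rewrite (node_ord v).
  move=> <-; rewrite /dirichlet /p mulr_sumr -big_split /=; apply: eq_bigr => k _.
  by rewrite !nodeD /d; ring.
rewrite mulNr -mulrN sbp.
apply: is_derive_eq.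
rewrite /GRing.scale /=; ring.
Qed.

(** * The potential [Phi]: minimum, coercivity and gap *)

Definition kirchhoff (R : realType) (a b : R) n (u : 'rV[R]_n) : R :=
  a / 4 * dirichlet u ^+ 2 + b / 2 * dirichlet u.

(** Completing the square gives the minimum [- b ^+ 2 / (4 * a)], reached where the Dirichlet energy
    is [- b / a]. By homogeneity a multiple of any vector of positive energy gets there. *)
Lemma kirchhoff_min (R : realType) (a b : R) n : 0 < a -> b < 0 -> (0 < n)%N ->
  exists e : 'rV[R]_n,
    kirchhoff a b e < 0 /\ forall u : 'rV[R]_n, kirchhoff a b e <= kirchhoff a b u.
Proof.
move=> a0 b0; case: n => // n _.
pose w : 'rV[R]_n.+1 := const_mx 1.
have qw : 0 < dirichlet w.
  have := coord_sqr_le w ord0; rewrite mxE expr1n => /(lt_le_trans ltr01).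
  by rewrite pmulr_rgt0// exprn_gt0.
have c0 : 0 < - b / (a * dirichlet w) by rewrite divr_gt0 ?oppr_gt0// mulr_gt0.
exists (Num.sqrt (- b / (a * dirichlet w)) *: w).
have qe : dirichlet (Num.sqrt (- b / (a * dirichlet w)) *: w) = - b / a.
  rewrite dirichletZ sqr_sqrtr ?ltW//.
  by field; rewrite !gt_eqF.
have ke : kirchhoff a b (Num.sqrt (- b / (a * dirichlet w)) *: w) = - (b ^+ 2 / (4 * a)).
  by rewrite /kirchhoff qe; field; rewrite gt_eqF.
have b2 : 0 < b ^+ 2 by rewrite exprn_even_gt0//= lt_eqF.
split; first by rewrite ke oppr_lt0 divr_gt0// mulr_gt0.
move=> u; rewrite ke -subr_ge0.
have -> : kirchhoff a b u - - (b ^+ 2 / (4 * a)) = a / 4 * (dirichlet u + b / a) ^+ 2.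
  by rewrite /kirchhoff; field; rewrite gt_eqF.
by rewrite mulr_ge0 ?sqr_ge0// divr_ge0// ltW.
Qed.

Lemma kirchhoff0 (R : realType) (a b : R) n : kirchhoff a b (0 : 'rV[R]_n) = 0.
Proof. by rewrite /kirchhoff dirichlet0 expr0n !mulr0 addr0. Qed.

Lemma kirchhoffN (R : realType) (a b : R) n (u : 'rV[R]_n) :
  kirchhoff a b (- u) = kirchhoff a b u.
Proof. by rewrite /kirchhoff dirichletN. Qed.

Lemma continuous_kirchhoff (R : realType) (a b : R) n :
  continuous (@kirchhoff R a b n).
Proof.
have cq : continuous (@dirichlet R n) by exact: continuous_dirichlet.
have cq2 : continuous (fun u : 'rV[R]_n => dirichlet u ^+ 2).
  by move=> u; exact: (continuousM (cq u) (cq u)).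
have cst (c : R) : continuous (fun _ : 'rV[R]_n => c) by exact: cst_continuous.
move=> u; exact: (continuousD (continuousM (cst (a / 4) u) (cq2 u))
                             (continuousM (cst (b / 2) u) (cq u))).
Qed.

Lemma quadratic_sublevel (R : realType) (p A c : R) : 0 < p ->
  exists2 M, 0 <= M & forall q, 0 <= q -> p * q ^+ 2 - A * q <= c -> q <= M.
Proof.
move=> p0; exists (1 + (`|A| + `|c|) / p).
  by rewrite addr_ge0// divr_ge0 ?addr_ge0// ltW.
move=> q q0 qc; have [q1|q1] := leP q 1.
  by rewrite ler_wpDr// divr_ge0 ?addr_ge0// ltW.
suff : q <= (`|A| + `|c|) / p by lra.
rewrite ler_pdivlMr//.
have Aq : A * q <= `|A| * q by rewrite ler_wpM2r// ler_norm.
have cq : c <= `|c| * q.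
  by rewrite (le_trans (ler_norm c))// ler_peMr// ltW.
have q00 : 0 < q by rewrite (lt_trans ltr01).
rewrite -(ler_pM2r q00); lra.
Qed.

(** By quadratic growth the sum over [F] is at most affine in the Dirichlet energy, whereas
    [kirchhoff] is quadratic in it with leading coefficient [a / 4 > 0]. *)
Lemma kirchhoff_coercive (R : realType) (a b rho c : R) n (F : 'I_n -> R -> R) :
  0 < a -> 0 <= rho ->
  (forall k, exists2 C, 0 <= C & forall t, `|F k t| <= C * t ^+ 2 + C) ->
  exists M, forall u : 'rV[R]_n,
    kirchhoff a b u - rho * \sum_k `|F k (u 0 k)| <= c -> `|u| <= M.
Proof.
move=> a0 rho0 growth.
have /choice[C CP] k : exists C, 0 <= C /\ forall t, `|F k t| <= C * t ^+ 2 + C.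
  by have [C C0 CF] := growth k; exists C.
pose L := \sum_k C k.
have L0 : 0 <= L by apply: sumr_ge0 => k _; case: (CP k).
have FL (u : 'rV[R]_n) : \sum_k `|F k (u 0 k)| <= L * (2 ^+ n * dirichlet u + 1).
  rewrite /L mulr_suml; apply: ler_sum => k _.
  have [C0 CF] := CP k; apply: le_trans (CF _) _.
  by rewrite mulrDr mulr1 lerD2r ler_wpM2l// coord_sqr_le.
have a40 : 0 < a / 4 by rewrite divr_gt0.
(* The two arguments collect the terms linear in the Dirichlet energy and the constant terms. *)
have [Q Q0 QP] := quadratic_sublevel (rho * L * 2 ^+ n - b / 2) (c + rho * L) a40.
have P0 : 0 <= 2 ^+ n * Q by rewrite mulr_ge0// exprn_ge0.
exists (1 + 2 ^+ n * Q) => u uc; apply: mx_norm_le; first by rewrite addr_ge0.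
have qQ : dirichlet u <= Q.
  apply: QP; first exact: dirichlet_ge0.
  have := ler_wpM2l rho0 (FL u); move: uc; rewrite /kirchhoff; lra.
move=> i k; rewrite ord1.
have : `|u 0 k| ^+ 2 <= 2 ^+ n * Q.
  rewrite real_normK ?num_real// (le_trans (coord_sqr_le _ _))//.
  by rewrite ler_wpM2l// exprn_ge0.
by have := normr_ge0 (u 0 k); nra.
Qed.

Lemma continuous_coord (R : realType) n (k : 'I_n) (h : R -> R) :
  continuous h -> continuous (fun u : 'rV[R]_n => h (u 0 k)).
Proof.
move=> ch u; apply: (continuous_comp (f := fun u : 'rV[R]_n => u 0 k)).
  exact: coord_continuous.
exact: ch.
Qed.

Lemma continuous_sum_coord (R : realType) n (F : 'I_n -> R -> R) :
  (forall k, continuous (F k)) ->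
  continuous (fun u : 'rV[R]_n => \sum_k F k (u 0 k)).
Proof.
by move=> cF; apply: continuous_sum => k; exact: continuous_coord.
Qed.

(** By coercivity the penalized potential attains its minimum. If that were [m], the penalty would
    vanish at the minimizer, which would then be [0], where the potential is [0 > m]. *)
Lemma kirchhoff_gap (R : realType) (a b rho m : R) n (F : 'I_n -> R -> R) :
  0 < a -> 0 < rho ->
  (forall k, continuous (F k)) ->
  (forall k, exists2 C, 0 <= C & forall t, `|F k t| <= C * t ^+ 2 + C) ->
  (forall k t, F k t = 0 -> t = 0) ->
  m < 0 -> (forall u : 'rV[R]_n, m <= kirchhoff a b u) ->
  exists2 gap, 0 < gap & forall u : 'rV[R]_n,
    m + gap <= kirchhoff a b u + rho * \sum_k `|F k (u 0 k)|.
Proof.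
move=> a0 rho0 cF growth F0 m0 mmin.
pose P (u : 'rV[R]_n) := kirchhoff a b u + rho * \sum_k `|F k (u 0 k)|.
have S0 (u : 'rV[R]_n) : 0 <= rho * \sum_k `|F k (u 0 k)|.
  by rewrite mulr_ge0 ?sumr_ge0// ltW.
have cP : continuous P.
  have cS : continuous (fun u : 'rV[R]_n => \sum_k `|F k (u 0 k)|).
    apply: (continuous_sum_coord (F := fun k t => `|F k t|)) => k t.
    by apply: (continuous_comp (f := F k)); [exact: cF|exact: norm_continuous].
  have cst : continuous (fun _ : 'rV[R]_n => rho) by exact: cst_continuous.
  move=> u; exact: (continuousD (@continuous_kirchhoff R a b n u)
                               (continuousM (cst u) (cS u))).
(* Weight [0] is enough here, as the penalty in [P] is nonnegative. *)
have [M MP] := kirchhoff_coercive b (P 0) a0 (lexx 0) growth.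
have PM u : P u <= P 0 -> `|u| <= M.
  move=> uP; apply: MP; rewrite mul0r subr0 (le_trans _ uP)// /P lerDl//.
have [|u0 _ u0min] := compact_min (f := P) _ (@compact_ball0 R n M) cP.
  by exists 0; exact: PM.
exists (P u0 - m) => [|u].
  rewrite subr_gt0 lt_neqAle (le_trans (mmin u0)) ?lerDl// andbT; apply/eqP => e.
  have e0 : rho * \sum_k `|F k (u0 0 k)| = 0.
    by apply/eqP; rewrite eq_le S0 andbT; have := mmin u0; rewrite e /P; lra.
  have u00 : u0 = 0.
    apply/rowP => k; rewrite mxE; apply: (F0 k); apply/eqP; rewrite -normr_eq0.
    move/eqP: e0; rewrite mulf_eq0 gt_eqF//= psumr_eq0// => /allP/(_ k).
    by rewrite mem_index_enum => /(_ isT).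
  by move: m0; rewrite e /P e0 u00 kirchhoff0 addr0 ltxx.
rewrite subrKC.
have [uM|Mu] := leP `|u| M; first exact: u0min.
apply: (@le_trans _ _ (P 0)); first by apply: u0min; exact: PM.
by rewrite leNgt; apply/negP => /ltW/PM; rewrite leNgt Mu.
Qed.

Lemma continuous_row (R : realType) (T : topologicalType) n
    (h : 'I_n -> T -> R) :
  (forall k, continuous (h k)) -> continuous (fun x => \row_k h k x).
Proof.
move=> ch x; apply/cvgrPdist_le => e e0.
have : \forall y \near x, forall k, `|h k x - h k y| <= e.
  by apply: filter_forall => k; move: e e0; apply/cvgrPdist_le; exact: ch.
apply: filterS => y hxy; apply: mx_norm_le => [|i k]; first exact: ltW.
by rewrite !mxE.
Qed.

(** * The energies [J_mu], their gradients and the equations *)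

Definition functional (R : realType) (a b : R) n (G F : 'I_n -> R -> R)
    (mu u : 'rV[R]_n) : R :=
  kirchhoff a b u - \sum_k G k (u 0 k) - \sum_k mu 0 k * F k (u 0 k).

(** Entry [k] is the left side minus the right side of the equation at the node [k.+1]. *)
Definition gradient (R : realType) (a b : R) n (g f : 'I_n -> R -> R)
    (mu u : 'rV[R]_n) : 'rV[R]_n :=
  \row_k (- (a * dirichlet u + b) * laplacian u k
          - g k (u 0 k) - mu 0 k * f k (u 0 k)).

Lemma is_derive_sum_coord (R : realType) n (G g : 'I_n -> R -> R)
    (u v : 'rV[R]_n) (t : R) :
  (forall k (s : R), is_derive s 1 (G k) (g k s)) ->
  is_derive t 1 (fun t : R => \sum_k G k ((u + t *: v) 0 k))
    (\sum_k g k ((u + t *: v) 0 k) * v 0 k).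
Proof.
move=> dG.
have dGk k : is_derive t 1 (fun t : R => G k ((u + t *: v) 0 k))
    (g k ((u + t *: v) 0 k) * v 0 k).
  have -> : (fun t : R => G k ((u + t *: v) 0 k)) =
      G k \o (fun t => u 0 k + t * v 0 k).
    by apply/funext => s; rewrite /= !mxE.
  apply: is_derive1_comp; first by rewrite !mxE; exact: dG.
  by apply: is_derive_eq; rewrite /GRing.scale /=; ring.
have -> : (fun t : R => \sum_k G k ((u + t *: v) 0 k)) =
    \sum_k (fun t : R => G k ((u + t *: v) 0 k)).
  by apply/funext => s; rewrite fct_sumE.
exact: is_derive_sum.
Qed.

Lemma is_derive_functional (R : realType) (a b : R) n (G F g f : 'I_n -> R -> R)
    (mu u v : 'rV[R]_n) (t : R) :
  (forall k (s : R), is_derive s 1 (G k) (g k s)) ->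
  (forall k (s : R), is_derive s 1 (F k) (f k s)) ->
  is_derive t 1 (fun t : R => functional a b G F mu (u + t *: v))
    (\sum_k gradient a b g f mu (u + t *: v) 0 k * v 0 k).
Proof.
move=> dG dF.
have dE := dirichlet_line u v t.
have dsG := is_derive_sum_coord u v t dG.
have dmF k (s : R) : is_derive s 1 (fun s => mu 0 k * F k s) (mu 0 k * f k s).
  have := dF k s => ?; apply: is_derive_eq; rewrite /GRing.scale /=; ring.
have dsF := is_derive_sum_coord u v t dmF.
have dK : is_derive t 1 (fun t : R => kirchhoff a b (u + t *: v))
    ((a * dirichlet (u + t *: v) + b) *
       - \sum_(k < n) laplacian (u + t *: v) k * v 0 k).
  by rewrite /kirchhoff; apply: is_derive_eq; rewrite /GRing.scale /=; field.
apply: (is_derive_eq (is_deriveB (is_deriveB dK dsG) dsF)).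
rewrite -sumrN mulr_sumr -!sumrB; apply: eq_bigr => k _.
by rewrite !mxE; ring.
Qed.

Lemma continuous_laplacian (R : realType) n k :
  continuous (fun u : 'rV[R]_n => laplacian u k).
Proof.
have cn j : continuous (fun u : 'rV[R]_n => node u j) by exact: continuous_node.
have cst (c : R) : continuous (fun _ : 'rV[R]_n => c) by exact: cst_continuous.
move=> u; exact: (continuousD (continuousB (cn k.+2 u)
  (continuousM (cst 2 u) (cn k.+1 u))) (cn k u)).
Qed.

Lemma continuous_gradient (R : realType) (a b : R) n (g f : 'I_n -> R -> R)
    (mu : 'rV[R]_n) :
  (forall k, continuous (g k)) -> (forall k, continuous (f k)) ->
  continuous (gradient a b g f mu).
Proof.
move=> cg cf; apply: continuous_row => k.
have cst (c : R) : continuous (fun _ : 'rV[R]_n => c) by exact: cst_continuous.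
have ck := @continuous_coord R n k.
have cq : continuous (@dirichlet R n) by exact: continuous_dirichlet.
have cl : continuous (fun u : 'rV[R]_n => laplacian u k).
  exact: continuous_laplacian.
move=> u; exact: (continuousB (continuousB
  (continuousM (continuousN (continuousD (continuousM (cst a u) (cq u)) (cst b u)))
    (cl u)) (ck _ (cg k) u)) (continuousM (cst (mu 0 k) u) (ck _ (cf k) u))).
Qed.

Lemma continuous_functional (R : realType) (a b : R) n (G F : 'I_n -> R -> R)
    (mu : 'rV[R]_n) :
  (forall k, continuous (G k)) -> (forall k, continuous (F k)) ->
  continuous (functional a b G F mu).
Proof.
move=> cG cF.
have csG := continuous_sum_coord cG.
have csF : continuous (fun u : 'rV[R]_n => \sum_k mu 0 k * F k (u 0 k)).
  apply: (continuous_sum_coord (F := fun k t => mu 0 k * F k t)) => k t.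
  by apply: continuousM; [exact: cvg_cst|exact: cF].
move=> u; exact: (continuousB (continuousB (@continuous_kirchhoff R a b n u)
  (csG u)) (csF u)).
Qed.

Lemma critical_is_solution (R : realType) (a b : R) n (g f : 'I_n -> R -> R)
    (mu u : 'rV[R]_n) :
  gradient a b g f mu u = 0 ->
  is_solution a b g f (mu 0) (\row_(i < n.+2) node u i).
Proof.
move=> gu0.
have xE k : (k < n.+2)%N -> coord (\row_(i < n.+2) node u i) k = node u k.
  by move=> kn; rewrite /coord mxE inordK.
split; [by rewrite xE|by rewrite xE// node_last|move=> k].
have -> : \sum_(1 <= m < n.+2) `|coord (\row_(i < n.+2) node u i) m -
    coord (\row_(i < n.+2) node u i) m.-1| ^+ 2 = dirichlet u.
  rewrite big_add1 big_mkord; apply: eq_bigr => m _ /=.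
  have mn : (m < n.+1)%N := ltn_ord m.
  by rewrite real_normK ?num_real// (xE m.+1 mn) (xE m (leqW mn)).
have kn : (k.+2 < n.+2)%N := ltn_ord k.
rewrite (xE _ kn) (xE _ (ltnW kn)) (xE _ (ltnW (ltnW kn))) node_ord.
have /rowP/(_ k) := gu0; rewrite !mxE /laplacian node_ord => /eqP.
by rewrite -addrA -opprD subr_eq0 => /eqP.
Qed.

(** * Three solutions *)

Lemma gradient_at_min (R : realType) (a b : R) n (G F g f : 'I_n -> R -> R)
    (mu x : 'rV[R]_n) :
  (forall k (s : R), is_derive s 1 (G k) (g k s)) ->
  (forall k (s : R), is_derive s 1 (F k) (f k s)) ->
  (forall u, functional a b G F mu x <= functional a b G F mu u) ->
  gradient a b g f mu x = 0.
Proof.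
move=> dG dF xmin; apply/rowP => k; rewrite [RHS]mxE.
pose v : 'rV[R]_n := \row_j (j == k)%:R.
have vE j : v 0 j = (j == k)%:R by rewrite mxE.
have := slope_at_min (fun t => is_derive_functional a b mu x v t dG dF) xmin.
rewrite scale0r addr0 (bigD1 k)//= big1 => [|j jk]; rewrite vE.
  by rewrite eqxx mulr1 addr0.
by rewrite (negbTE jk) mulr0.
Qed.

(** The mountain pass lemma with the gradient itself as descent field: [psi z 0] is then the sum of
    the squares of its entries and vanishes only at critical points. *)
Lemma third_critical_point (R : realType) (a b : R) n (G F g f : 'I_n -> R -> R)
    (mu x y : 'rV[R]_n) (J := functional a b G F mu) :
  (forall k, continuous (g k)) -> (forall k, continuous (f k)) ->
  (forall k (s : R), is_derive s 1 (G k) (g k s)) ->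
  (forall k (s : R), is_derive s 1 (F k) (f k s)) ->
  (forall c, exists M, forall u, J u <= c -> `|u| <= M) ->
  x <> y -> (forall u, J x <= J u) -> (forall u, J y <= J u) ->
  exists z, [/\ gradient a b g f mu z = 0, z <> x & z <> y].
Proof.
move=> cg cf dG dF coer xy xmin ymin.
pose W := gradient a b g f mu.
have cW : continuous W by exact: continuous_gradient.
pose psi (z : 'rV[R]_n) (t : R) := \sum_k W (z - t *: W z) 0 k * W z 0 k.
have cont (H h : 'I_n -> R -> R) :
    (forall k (s : R), is_derive s 1 (H k) (h k s)) -> forall k, continuous (H k).
  move=> dH k s.
  have dHks : derivable (H k) s 1 by case: (dH k s).
  by apply: differentiable_continuous; apply/derivable1_diffP.
have ccoord k : continuous (fun z : 'rV[R]_n => z 0 k).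
  exact: coord_continuous.
have cWk k : continuous (fun z : 'rV[R]_n => W z 0 k).
  by move=> z; exact: (continuous_comp (cW z) (ccoord k (W z))).
have psi0 z : psi z 0 = \sum_k W z 0 k ^+ 2.
  by apply: eq_bigr => k _; rewrite scale0r subr0 expr2.
have [|||||z [z0 zx zy]] :=
    @mountain_pass R 'rV[R]_n J W psi x y (@compact_ball0 R n) _ coer cW _ _ _ _
      xy xmin ymin.
- by apply: continuous_functional; exact: cont.
- apply: continuous_sum => k.
  have cfst (h : 'rV[R]_n -> 'rV[R]_n) : continuous h ->
      continuous (fun p : 'rV[R]_n * R => h p.1).
    by move=> ch p; exact: (continuous_comp cvg_fst (ch p.1)).
  have c1 : continuous (fun p : 'rV[R]_n * R => p.1 - p.2 *: W p.1).
    by move=> p; apply: cvgB; [exact: cvg_fst|apply: cvgZ; [exact: cvg_snd|exact: cfst]].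
  have c2 : continuous (fun p : 'rV[R]_n * R => W p.1 0 k).
    by move=> p; exact: (continuous_comp cvg_fst (cWk k p.1)).
  by move=> p; exact: (continuousM (continuous_comp (c1 p) (cWk k _)) (c2 p)).
- move=> z t; have := is_derive_functional a b mu z (- W z) t dG dF.
  rewrite scalerN /psi -sumrN => dJ.
  under eq_fun do rewrite -scalerN.
  apply: (is_derive_eq dJ); apply: eq_bigr => k _.
  by rewrite [(- W z) 0 k]mxE mulrN.
- by move=> z; rewrite psi0 sumr_ge0// => k _; exact: sqr_ge0.
- move=> z /eqP; rewrite psi0 psumr_eq0 => [/allP z0|k _]; last exact: sqr_ge0.
  apply/rowP => k; rewrite [RHS]mxE; apply/eqP; rewrite -sqrf_eq0.
  by apply: z0; rewrite mem_index_enum.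
exists z; split => //; apply/rowP => k; rewrite [RHS]mxE.
move/eqP: z0; rewrite psi0 psumr_eq0 => [/allP z0|j _]; last exact: sqr_ge0.
by apply/eqP; rewrite -sqrf_eq0; apply: z0; rewrite mem_index_enum.
Qed.

Theorem corollary2p1 (R : realType) (n : nat) (hn : (1 <= n)%N)
  (f : 'I_n -> R -> R)
  (hf : forall k, continuous (f k))
  (hb : forall k,
     (limf_esup (fun t : R => (`|int0 (f k) t| / t ^+ 2)%:E)
        (abs_pinfty_nbhs R) < +oo)%E)
  (hc : forall k, (forall t : R, int0 (f k) (- t) = - int0 (f k) t) /\
                  (forall t : R, int0 (f k) t = 0 <-> t = 0))
  (a r b : R) (ha : 0 < a) (hr : 0 < r) (hb0 : b < 0) :
  exists2 delta : R, 0 < delta &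
    forall g : 'I_n -> R -> R,
      (forall k, continuous (g k)) ->
      (\big[maxe/-oo]_(k < n) oscillation (int0 (g k)) < delta%:E)%E ->
      exists2 mu : 'I_n -> R, \sum_(k < n) `|mu k| ^+ 2 < r ^+ 2 &
        exists x y z : 'rV[R]_n.+2,
          [/\ x <> y, x <> z & y <> z] /\
          [/\ is_solution a b g f mu x,
              is_solution a b g f mu y &
              is_solution a b g f mu z].
Proof.
pose F k := int0 (f k).
have cF k : continuous (F k) by exact: continuous_int0.
have dF k (s : R) : is_derive s 1 (F k) (f k s) by exact: is_derive_int0.
have growth k := quadratic_growth (cF k) (hb k).
have F0 k t : F k t = 0 -> t = 0 by case: (hc k) => _ /(_ t)[].
have F00 k : F k 0 = 0 by case: (hc k) => _ /(_ 0)[_]; apply.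
have FN k t : F k (- t) = - F k t by case: (hc k) => /(_ t).
have n0 : 0 < n%:R :> R by rewrite ltr0n.
(* This choice gives [n * rho ^+ 2 < r ^+ 2], so the cube lies in the open ball of radius [r]. *)
pose rho := r / n.+1%:R.
have rho0 : 0 < rho by rewrite divr_gt0.
have [e [e0 emin]] := kirchhoff_min ha hb0 hn.
have [gap gap0 gapP] := kirchhoff_gap ha rho0 cF growth F0 e0 emin.
exists (gap / n%:R); first by rewrite divr_gt0.
move=> g cg oscg.
pose G k := int0 (g k).
have cG k : continuous (G k) by exact: continuous_int0.
have dG k (s : R) : is_derive s 1 (G k) (g k s) by exact: is_derive_int0.
have GB (u v : 'rV[R]_n) : \sum_k G k (u 0 k) - \sum_k G k (v 0 k) < gap.
  have /bigmax_ltP[_ og] := oscg.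
  have -> : gap = \sum_(k < n) (gap / n%:R).
    by rewrite sumr_const card_ord -[RHS]mulr_natr divfK// gt_eqF.
  rewrite -sumrB; apply: ltr_sum => [|k _]; last exact/oscillation_lt/og.
  by apply/hasP; exists (Ordinal hn) => //; rewrite mem_index_enum.
pose J (mu u : 'rV[R]_n) := functional a b G F mu u.
(* The value at [0] is the same for all [mu], which lets one ball serve all parameters below. *)
have J0 mu : J mu 0 = - \sum_k G k ((0 : 'rV[R]_n) 0 k).
  rewrite /J /functional kirchhoff0 sub0r [X in _ - X]big1 ?subr0// => k _.
  by rewrite mxE F00 mulr0.
have muF (mu u : 'rV[R]_n) : `|mu| <= rho ->
    \sum_k mu 0 k * F k (u 0 k) <= rho * \sum_k `|F k (u 0 k)|.
  move=> murho; rewrite (le_trans (ler_norm _))// (le_trans (pairing_le _ _))//.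
  by rewrite ler_wpM2r// sumr_ge0.
(* Uniform in [mu]: over the cube the [F] terms are bounded by their weight [rho], and [GB] bounds
   the [G] terms by [gap] plus their sum at [0]. *)
have coer c : exists M, forall mu u, `|mu| <= rho -> J mu u <= c -> `|u| <= M.
  have [M MP] := kirchhoff_coercive b
    (c + gap + \sum_k G k ((0 : 'rV[R]_n) 0 k)) ha (ltW rho0) growth.
  exists M => mu u /(muF _ u) murho uc; apply: MP.
  by have := GB u 0; move: murho uc; rewrite /J /functional; lra.
suff [mu [x [y [murho xy xmin ymin]]]] : exists mu x y,
    [/\ `|mu| <= rho, x <> y, forall u, J mu x <= J mu u &
       forall u, J mu y <= J mu u].
  have [z [gz zx zy]] : exists z, [/\ gradient a b g f mu z = 0, z <> x & z <> y].
    apply: (third_critical_point cg hf dG dF) => // c.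
    by have [M MP] := coer c; exists M => u; exact: MP.
  exists (mu 0).
    apply: (@le_lt_trans _ _ (\sum_(k < n) rho ^+ 2)).
      apply: ler_sum => k _.
      have : `|mu 0 k| <= rho by rewrite (le_trans (coord_le_norm _ _ _)).
      by apply: lerXn2r; rewrite ?nnegrE// ltW.
    have rE : r = rho * (n%:R + 1) by rewrite /rho natr1 divfK// pnatr_eq0.
    rewrite sumr_const card_ord -[ltLHS]mulr_natr rE.
    rewrite [(rho * _) ^+ 2]exprMn ltr_pM2l ?exprn_gt0//; nra.
  pose ext (u : 'rV[R]_n) := \row_(i < n.+2) node u i.
  have ext_inj u v : u <> v -> ext u <> ext v.
    move=> uv euv; apply: uv; apply/rowP => k.
    have /rowP/(_ (lift ord0 (widen_ord (leqnSn n) k))) := euv.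
    by rewrite !mxE /= !node_ord.
  exists (ext x), (ext y), (ext z); split.
    by split; apply: ext_inj => // /esym.
  split; apply: critical_is_solution => //; exact: gradient_at_min dG dF _.
(* Outside this ball every [J mu] exceeds its value at [0], so minimizers over the compact ball are
   global. *)
have [M MP] := coer (J 0 0).
have XJ mu u : `|mu| <= rho -> M < `|u| -> J mu 0 < J mu u.
  move=> murho Mu; rewrite ltNge; apply/negP => uJ.
  by have := MP mu u murho; rewrite J0 -(J0 mu) => /(_ uJ); rewrite leNgt Mu.
have M0 : `|0 : 'rV[R]_n| <= M by apply: (MP 0) => //; rewrite normr0 ltW.
have Xmin mu x : `|mu| <= rho ->
    (forall u, `|u| <= M -> J mu x <= J mu u) -> forall u, J mu x <= J mu u.
  move=> murho xmin u; have [|Mu] := leP `|u| M; first exact: xmin.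
  by rewrite (le_trans (xmin 0 M0))// ltW// XJ.
(* Without two global minimizers for a common [mu], the uniqueness hypothesis of [saddle_point]
   holds on the ball. *)
apply: contrapT => no.
have [|||mu x y murho Xx Xy xmin ymin|mu0 [x0 [mu0rho Xx0 sad]]] :=
  @saddle_point R 'rV[R]_n n [set u | `|u| <= M]
    (fun u => kirchhoff a b u - \sum_k G k (u 0 k)) (fun k u => F k (u 0 k)) rho
    _ (@compact_ball0 R n M) _ _ (ltW rho0) _.
- by exists 0.
- have csG := continuous_sum_coord cG.
  by move=> u; exact: (continuousB (@continuous_kirchhoff R a b n u) (csG u)).
- by move=> k; exact: continuous_coord.
- apply: contrapT => xy; apply: no; exists mu, x, y.
  by split => //; exact: Xmin.
have sad' mu u : `|mu| <= rho -> J mu x0 <= J mu0 u.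
  move=> murho; have [uM|Mu] := leP `|u| M; first exact: sad.
  by rewrite (le_trans (sad mu 0 murho M0))// ltW// XJ.
have [x [xe xF]] : exists x, kirchhoff a b x = kirchhoff a b e /\
    0 <= \sum_k mu0 0 k * F k (x 0 k).
  have [e1|e1] := leP 0 (\sum_k mu0 0 k * F k (e 0 k)); first by exists e.
  exists (- e); rewrite kirchhoffN; split => //.
  rewrite -oppr_le0 -sumrN (le_trans _ (ltW e1))// ler_sum// => k _.
  by rewrite mxE FN mulrN opprK.
pose mu : 'rV[R]_n := \row_k (- rho * Num.sg (F k (x0 0 k))).
have murho : `|mu| <= rho.
  apply: mx_norm_le => [|i k]; first exact: ltW.
  rewrite mxE mulNr normrN normrM gtr0_norm// ler_piMr//; first exact: ltW.
  by rewrite normr_sg lern1 leq_b1.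
have := sad' mu x murho.
have -> : J mu x0 = kirchhoff a b x0 - \sum_k G k (x0 0 k) +
    rho * \sum_k `|F k (x0 0 k)|.
  rewrite /J /functional; congr (_ - _ + _); rewrite mulr_sumr -sumrN.
  apply: eq_bigr => k _; rewrite mxE normrEsg; ring.
(* The saddle inequality leaves [gap] at most the difference of the [G] sums at [x0] and [x],
   against [GB]. *)
have := gapP x0; have := GB x0 x; rewrite /J /functional xe; lra.
Qed.
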